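(* For every fixed integer $d\ge 1$, as $n\to\infty$, $K_{n,d}/n^{1-1/(2d)}$ converges in distribution to a random variable $W_d$ with \[ \mathbb{P}(W_d>x)=e^{-x^{2d}},\qquad x\ge 0. \] Thus $W_d$ is Weibull with shape parameter $2d$ and scale $1$. For $d=1$ this limit is the Rayleigh law with tail $e^{-x^2}$, $x\ge 0$.
   Context: Fix an integer $d\ge1$. For $n>2d+1$, let $C_n^d$ be the $d$th power of the cycle: the graph on vertex set $\mathbb{Z}/n\mathbb{Z}$ in which two distinct vertices are adjacent when their cyclic distance is at most $d$. Let $\pi=(\pi_1,\dots,\pi_n)$ be a uniformly random ordering of the vertices, and $A_t=\{\pi_1,\dots,\pi_t\}$. Let $\tau_{n,d}$ be the largest $t$ such that the induced subgraph $C_n^d[A_t]$ contains an isolated vertex (a vertex of $A_t$ with no neighbor in $A_t$), and put $K_{n,d}=n-\tau_{n,d}$. The Weibull law with shape $\alpha>0$ and scale $1$ has tail $x\mapsto e^{-x^\alpha}$, $x\ge0$. *)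

(* Defs.v *)
From HB Require Import structures.
From mathcomp Require Export all_boot all_order all_algebra all_fingroup.
From mathcomp Require Export all_classical all_reals all_analysis.

Set Implicit Arguments.
Unset Strict Implicit.
Unset Printing Implicit Defensive.

Import Order.TTheory GRing.Theory Num.Theory.
Import numFieldNormedType.Exports.

Local Open Scope classical_set_scope.
Local Open Scope ring_scope.

(* The vertex set Z/nZ is represented by the residues 'I_n: since 'Z_n is not
   Z/nZ for n < 2, 'I_n makes sense uniformly in n. *)
Definition cyclic_dist (n : nat) (u v : 'I_n) : nat :=
  minn ((u + (n - v)) %% n) ((v + (n - u)) %% n).

Definition cycle_power (n d : nat) : rel 'I_n :=
  fun u v => (u != v) && (cyclic_dist u v <= d)%N.

Definition induced_isolated (T : finType) (e : rel T) (A : {set T}) (v : T) :=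
  (v \in A) && [forall u, (u \in A) ==> ~~ e v u].

(* [s i] is the vertex in position [i]; positions are counted from 0, so that
   the first [t] vertices are the [s i] with [i < t]. *)
Definition ordering (n : nat) := {perm 'I_n}.

Definition first_vertices (n : nat) (s : ordering n) (t : nat) : {set 'I_n} :=
  [set s i | i : 'I_n & (i < t)%N]%SET.

Definition tau (n d : nat) (s : ordering n) : nat :=
  \max_(t < n.+1 |
        [exists v, induced_isolated (cycle_power d) (first_vertices s t) v]) t.

Definition K (n d : nat) (s : ordering n) : nat := (n - tau d s)%N.

HB.instance Definition _ (n : nat) := Finite.on (ordering n).
HB.instance Definition _ (n : nat) := isPointed.Build (ordering n) 1%g.
HB.instance Definition _ (n : nat) :=
  @isMeasurable.Build default_measure_display (ordering n) discrete_measurable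
    discrete_measurable0 discrete_measurableC discrete_measurableU.

Definition uniform_ordering (disp : measure_display) (T : measurableType disp)
    (R : realType) (P : probability T R) (n : nat)
    (pi : {RV P >-> ordering n}) :=
  forall s : ordering n, distribution P pi [set s] = ((n`!)%:R^-1)%:E.

Definition scaled_K (R : realType) (d n : nat) (s : ordering n) : R :=
  (K d s)%:R / n%:R `^ (1 - ((2 * d)%N%:R)^-1).

Lemma measurable_scaled_K (R : realType) (d n : nat) :
  measurable_fun [set: ordering n] (@scaled_K R d n).
Proof. by []. Qed.

HB.instance Definition _ (R : realType) (d n : nat) :=
  isMeasurableFun.Build _ _ (ordering n) R (@scaled_K R d n)
    (@measurable_scaled_K R d n).

(* Pointwise convergence of the distribution functions at the continuity points
   of the limit; each [X n] may live on its own probability space. *)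
Definition cvg_in_distribution (R : realType)
    (disp : nat -> measure_display) (T : forall n, measurableType (disp n))
    (P : forall n, probability (T n) R) (X : forall n, {RV (P n) >-> R})
    (disp' : measure_display) (T' : measurableType disp')
    (Q : probability T' R) (W : {RV Q >-> R}) :=
  forall x : R, {for x, continuous (cdf W)} ->
    cdf (X n) x @[n --> \oo] --> cdf W x.
Arguments cvg_in_distribution {R disp T} P X {disp' T' Q} W.

Definition weibull (R : realType) (alpha : R) (disp : measure_display)
    (T : measurableType disp) (Q : probability T R) (W : {RV Q >-> R}) :=
  0 < alpha /\
  forall x : R, 0 <= x -> ccdf W x = (expR (- (x `^ alpha)))%:E.

(* Main.v *)
From HB Require Import structures.
Require Import Defs.
From mathcomp Require Import zify ring lra.

Set Implicit Arguments.
Unset Strict Implicit.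
Unset Printing Implicit Defensive.

Import Order.TTheory GRing.Theory Num.Theory.
Import numFieldNormedType.Exports.

(** Read the ordering backwards: the vertices are deleted one by one, starting
    with the last.  A vertex becomes isolated when its 2d neighbours have been
    deleted while it is still there, and [K] is the number of deletions made
    when this first happens.  Hence, if B is the set of the last k vertices,
    [K <= k] forces some neighbourhood to lie in B ([K_le_covered]), and
    conversely a neighbourhood of v inside B gives [K <= k] unless v itself is
    in B ([covered_K_le]).  The exceptional case needs 2d+1 prescribed vertices
    in B and is negligible, so everything reduces to the probability that a
    uniform k-set contains no neighbourhood.  With k = x n^(1-1/2d) the expected
    number of neighbourhoods inside B is about n (k/n)^(2d) = x^(2d), and their
    number should be asymptotically Poisson, whence exp(-x^(2d)).

    Poisson approximation is done for a random set B that contains each vertex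
    independently with probability p.  Adding the neighbourhoods N v one at a
    time, let q_m be the probability that none of the first m lies in B.  The
    event [N v \subset B] is independent of everything that concerns only
    neighbourhoods disjoint from N v, and there are boundedly many others, each
    of which costs at least one further vertex to be covered together with N v.
    Therefore q_(m+1) = (1 - p^(2d)) q_m + O(p^(2d+1)), and iterating gives
    q_n = exp(-n p^(2d)) + O(n p^(2d+1)) ([bern_prob_uncovered]).

    To return to a set of fixed size, average a monotone function of B over all
    relabellings of the vertices: the result depends on the cardinality of B
    only, and is monotone in it.  So the average over k-sets is squeezed between
    the expectations for values of p slightly below and slightly above k/n, up
    to the probability that the binomial variable #|B| is on the wrong side of
    k ([perm_avg_le], [perm_avg_ge]), which Chebyshev's inequality bounds
    ([bern_prob_card]).  With r = n^(-1/2d), the density p = y r makes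
    n p^(2d) = y^(2d) exact and all error terms O(r); letting n tend to infinity
    and then y to x proves the limit ([survival_cvg]). *)

(** * Neighbourhoods in the power of a cycle *)

Section CyclePower.
Variables (n d : nat).
Implicit Types (u v w : 'I_n) (s : ordering n).

Definition nbhd v : {set 'I_n} := [set u | cycle_power d v u].

Definition closed_nbhd v : {set 'I_n} := v |: nbhd v.

(** Without remainders, the distance is within reach of linear arithmetic. *)
Lemma cyclic_distE u v :
  cyclic_dist u v = minn (maxn u v - minn u v) (n - (maxn u v - minn u v)).
Proof.
have [un vn] := (ltn_ord u, ltn_ord v); rewrite /cyclic_dist.
have -> : ((u + (n - v)) %% n = if v <= u then u - v else u + n - v)%N.
  case: leqP => uv.
    by rewrite (_ : u + (n - v) = u - v + n)%N ?modnDr ?modn_small; lia.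
  by rewrite modn_small; lia.
have -> : ((v + (n - u)) %% n = if u <= v then v - u else v + n - u)%N.
  case: leqP => uv.
    by rewrite (_ : v + (n - u) = v - u + n)%N ?modnDr ?modn_small; lia.
  by rewrite modn_small; lia.
by case: (leqP v u); case: (leqP u v); lia.
Qed.

Lemma mem_nbhd u v : (u \in nbhd v) =
  (v != u :> nat) &&
  ((maxn u v - minn u v <= d) || (n - (maxn u v - minn u v) <= d))%N.
Proof.
by rewrite inE /cycle_power cyclic_distE geq_min maxnC minnC.
Qed.

Lemma nbhd_sym u v : (u \in nbhd v) = (v \in nbhd u).
Proof. by rewrite !mem_nbhd eq_sym maxnC minnC. Qed.

Lemma nbhd_irrefl v : v \notin nbhd v.
Proof. by rewrite mem_nbhd eqxx. Qed.

(** The residue of v + k - d modulo n, for v < n and k <= 2d < n; case analysis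
    replaces the remainder for the sake of linear arithmetic. *)
Definition shift_nat (v k : nat) : nat :=
  let x := (v + n + k - d)%N in
  if (2 * n <= x)%N then (x - 2 * n)%N else if (n <= x)%N then (x - n)%N else x.

(** The closed neighbourhood is the window v - d, ..., v + d, which does not
    wrap onto itself because 2d < n. *)
Lemma card_closed_nbhd v : (2 * d < n)%N -> #|closed_nbhd v| = (2 * d).+1.
Proof.
move=> dn; have vn := ltn_ord v.
have ltS (k : 'I_(2 * d).+1) : (shift_nat v k < n)%N.
  by have := ltn_ord k; rewrite /shift_nat; case: ifP; [|case: ifP]; lia.
pose f k := Ordinal (ltS k).
have inj_f : injective f.
  move=> j k /(congr1 val) /=; have := ltn_ord j; have := ltn_ord k.
  move=> kd jd jk; apply/val_inj => /=; move: jk; rewrite /shift_nat.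
  by do ![case: ifP => ?]; lia.
rewrite -[RHS]card_ord -(card_imset predT inj_f); apply: eq_card => u.
have un := ltn_ord u.
apply/idP/imsetP => [|[k _ ->]].
  move=> uv; have uv' : ((maxn u v - minn u v <= d) ||
      (n - (maxn u v - minn u v) <= d))%N.
    move: uv; rewrite 2!inE => /orP[/eqP->|]; first by rewrite maxnn minnn subnn.
    by rewrite mem_nbhd => /andP[].
  pose k := (if v <= u then if u - v <= d then u - v + d else d - (n - (u - v))
             else if v - u <= d then d - (v - u) else d + (n - (v - u)))%N.
  have kd : (k < (2 * d).+1)%N by rewrite /k; move: uv'; do ![case: ifP => ?]; lia.
  exists (Ordinal kd) => //; apply: val_inj => /=.
  move: uv'; rewrite /k; case: (leqP v u) => ?; case: leqP => ? ?;
    by rewrite /shift_nat; do ![case: ifP => ?]; lia.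
have kd := ltn_ord k.
rewrite 2!inE mem_nbhd -val_eqE /= eq_sym; case: eqP => //= _.
by rewrite /shift_nat; do ![case: ifP => ?]; lia.
Qed.

Lemma card_nbhd v : (2 * d < n)%N -> #|nbhd v| = (2 * d)%N.
Proof.
by move=> /(card_closed_nbhd v); rewrite cardsU1 nbhd_irrefl => -[].
Qed.

(** A vertex is the midpoint of the two extreme elements of its neighbourhood.
    These determine it as soon as 4d < n; for n = 2d+2 antipodal vertices do
    have equal neighbourhoods. *)
Lemma nbhd_inj : (0 < d)%N -> (4 * d < n)%N -> injective nbhd.
Proof.
move=> d0 dn v w vw; have [vn wn] := (ltn_ord v, ltn_ord w).
have ltr : ((if v + d < n then v + d else v + d - n) < n)%N by case: ifP; lia.
have ltl : ((if d <= v then v - d else v + n - d) < n)%N by case: ifP; lia.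
(* The extreme neighbours v + d and v - d. *)
have r : Ordinal ltr \in nbhd v by rewrite mem_nbhd /=; case: ifP; lia.
have l : Ordinal ltl \in nbhd v by rewrite mem_nbhd /=; case: ifP; lia.
rewrite vw !mem_nbhd /= in r l.
by apply: val_inj => /=; move: r l; do ![case: ifP => ?]; lia.
Qed.

(** A common element of two neighbourhoods gives a path of length two. *)
Lemma nbhd_overlap v : (2 * d < n)%N ->
  (#|[set w | ~~ [disjoint nbhd w & nbhd v]]| <= (2 * d) * (2 * d))%N.
Proof.
move=> dn; apply: (@leq_trans #|\bigcup_(u in nbhd v) nbhd u|).
  apply/subset_leq_card/fintype.subsetP => w; rewrite inE => /pred0Pn [u /andP[/= uw uv]].
  by apply/bigcupP; exists u => //; rewrite nbhd_sym.
apply: (@leq_trans (\sum_(u in nbhd v) #|nbhd u|)).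
  apply: (big_ind2 (fun (A : {set 'I_n}) m => #|A| <= m)%N).
  - by rewrite cards0.
  - by move=> A a B b Aa Bb; rewrite cardsU (leq_trans (leq_subr _ _)) ?leq_add.
  - by [].
rewrite (eq_bigr (fun=> 2 * d)%N) => [|u _]; last exact: card_nbhd.
by rewrite sum_nat_const card_nbhd.
Qed.

(** * The last vertices of an ordering, and K *)

Definition last_positions (k : nat) : {set 'I_n} := [set i : 'I_n | (n - k <= i)%N].

Lemma card_last_positions k : (k <= n)%N -> #|last_positions k| = k.
Proof.
move=> kn.
have ltS (j : 'I_k) : (n - k + j < n)%N by have := ltn_ord j; lia.
have inj_f : injective (fun j => Ordinal (ltS j)).
  by move=> i j /(congr1 val) /= ij; apply: val_inj => /=; lia.
rewrite -[RHS]card_ord -(card_imset predT inj_f); apply: eq_card => i.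
rewrite inE; apply/idP/imsetP => [ki|[j _ ->]]; last exact: leq_addr.
have jk : (i - (n - k) < k)%N by have := ltn_ord i; lia.
by exists (Ordinal jk) => //; apply: val_inj => /=; lia.
Qed.

Lemma setC_first_vertices s k :
  ~: first_vertices s (n - k) = s @: last_positions k.
Proof.
apply/finset.setP => v; rewrite inE; have [i ->] : exists i, v = s i.
  by exists (s^-1%g v); rewrite permKV.
rewrite (mem_imset _ _ (@perm_inj _ s)) inE leqNgt; congr (~~ _).
apply/imsetP/idP => [[j]|ik]; last by exists i; rewrite ?inE.
by rewrite inE => jk /perm_inj ->.
Qed.

(** At the time [tau] at which some vertex is isolated, its neighbours are among
    the last n - tau <= k vertices. *)
Lemma K_le_covered s k : (k < n)%N -> (K d s <= k)%N ->
  [exists v, nbhd v \subset s @: last_positions k].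
Proof.
move=> kn; apply: contraLR => /existsPn nocov; rewrite -ltnNge /K.
have : (tau d s <= (n - k).-1)%N; last by lia.
apply/bigmax_leqP => t /existsP [v /andP[_ /forallP iso]].
rewrite leqNgt; apply: contra (nocov v) => tk.
rewrite -setC_first_vertices; apply/fintype.subsetP => u uv.
rewrite inE; apply/negP => uA; move: uv; rewrite inE; apply/negP.
have /implyP := iso u; apply; move: uA => /imsetP [i]; rewrite inE => ik ->.
by apply/imsetP; exists i; rewrite // inE; lia.
Qed.

(** The vertex v is then isolated in what is left after deleting the last k. *)
Lemma covered_K_le s k v : nbhd v \subset s @: last_positions k ->
  v \notin s @: last_positions k -> (K d s <= k)%N.
Proof.
rewrite -setC_first_vertices inE negbK => sub vA.
have tk : (n - k < n.+1)%N by rewrite ltnS leq_subr.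
suff : (n - k <= tau d s)%N by rewrite /K; lia.
have iso : [exists v, induced_isolated (cycle_power d) (first_vertices s (n - k)) v].
  apply/existsP; exists v; rewrite /induced_isolated vA /=.
  apply/forallP => u; apply/implyP => uA; apply/negP => vu.
  by move/fintype.subsetP/(_ u): sub; rewrite !inE uA => /(_ vu).
exact: (@leq_bigmax_cond _ (fun t : 'I_n.+1 =>
  [exists v, induced_isolated (cycle_power d) (first_vertices s t) v])
  (fun t => nat_of_ord t) (Ordinal tk) iso).
Qed.

End CyclePower.

(** * Random sets with independent elements *)

Local Open Scope ring_scope.

Section BernoulliSet.
Variables (R : realType) (T : finType).
Implicit Types (p : R) (A B S : {set T}) (f g : {set T} -> R).

Definition bern_weight p B : R := p ^+ #|B| * (1 - p) ^+ #|~: B|.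

Definition bern_exp p f : R := \sum_B bern_weight p B * f B.

Definition bern_prob p (E : pred {set T}) : R :=
  bern_exp p (fun B => (E B)%:R).

Lemma bern_weight_ge0 p B : 0 <= p <= 1 -> 0 <= bern_weight p B.
Proof.
by case/andP=> p0 p1; rewrite mulr_ge0 ?exprn_ge0 ?subr_ge0.
Qed.

Lemma eq_bern_exp p f g : f =1 g -> bern_exp p f = bern_exp p g.
Proof. by move=> fg; apply: eq_bigr => B _; rewrite fg. Qed.

Lemma le_bern_exp p f g : 0 <= p <= 1 -> (forall B, f B <= g B) ->
  bern_exp p f <= bern_exp p g.
Proof.
by move=> p01 fg; apply: ler_sum => B _; rewrite ler_wpM2l ?bern_weight_ge0.
Qed.

Lemma bern_expD p f g :
  bern_exp p (fun B => f B + g B) = bern_exp p f + bern_exp p g.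
Proof. by rewrite -big_split; apply: eq_bigr => B _; rewrite mulrDr. Qed.

Lemma bern_expZ p c f : bern_exp p (fun B => c * f B) = c * bern_exp p f.
Proof. by rewrite mulr_sumr; apply: eq_bigr => B _; rewrite mulrCA. Qed.

Lemma bern_exp_sum p (I : Type) (r : seq I) (P : pred I)
    (F : I -> {set T} -> R) :
  bern_exp p (fun B => \sum_(i <- r | P i) F i B) =
  \sum_(i <- r | P i) bern_exp p (F i).
Proof.
by rewrite /bern_exp exchange_big; apply: eq_bigr => B _; rewrite mulr_sumr.
Qed.

Lemma bern_exp_cst p c : bern_exp p (fun=> c) = c.
Proof.
rewrite /bern_exp -mulr_suml -[RHS]mul1r; congr (_ * _).
transitivity (\prod_(i : T) (p + (1 - p))); last first.
  by rewrite addrC subrK big1.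
rewrite (@bigA_distr _ _ _ _ _ T (fun=> p) (fun=> 1 - p)).
apply: eq_bigr => B _; rewrite (bigID (mem B)) /=.
under eq_bigr => i iB do rewrite iB.
under [X in _ = _ * X]eq_bigr => i iB do rewrite (negPf iB).
rewrite !prodr_const; congr (_ * _ ^+ _).
by apply: eq_card => i; rewrite !inE.
Qed.

(** Pairing [B] with [B :\ i]: [f] takes the same value on both sets of a pair,
    and the one with [i] carries the fraction [p] of their joint weight. *)
Lemma bern_exp_mem p (i : T) f : (forall B, f (B :\ i) = f B) ->
  bern_exp p (fun B => (i \in B)%:R * f B) = p * bern_exp p f.
Proof.
move=> fi; rewrite /bern_exp (bigID (fun B => i \in B)) /=.
rewrite [X in _ + X]big1 ?addr0 => [|B /negPf->]; last by rewrite mul0r mulr0.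
rewrite [in RHS](bigID (fun B => i \in B)) /=.
rewrite [X in _ + X](reindex_onto (fun B => B :\ i) (fun B => i |: B)) /=;
  last by move=> B iB; rewrite finset.setU1K.
rewrite [X in _ + X](eq_bigl (fun B => i \in B)); last first.
  move=> B; rewrite !inE eqxx /=; apply/eqP/idP => [<-|iB].
    by rewrite !inE eqxx.
  by rewrite finset.setD1K.
rewrite -big_split mulr_sumr; apply: eq_bigr => B iB.
have cC : #|~: (B :\ i)| = #|~: B|.+1.
  by rewrite finset.setCD finset.setUC (cardsU1 i) !inE iB.
rewrite /= iB fi /bern_weight cC (cardsD1 i B) iB add1n !exprS.
by rewrite mul1r; ring.
Qed.

(** Independence: [f] looks only outside [S], while the event that [S] is
    covered looks only inside. *)
Lemma bern_exp_subset p S f : (forall B, f (B :\: S) = f B) ->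
  bern_exp p (fun B => (S \subset B)%:R * f B) = p ^+ #|S| * bern_exp p f.
Proof.
elim: {S}_.+1 {-2}S (ltnSn #|S|) f => // m IH S; rewrite ltnS => Sm f fS.
have [->|[i iS]] := set_0Vmem S.
  by rewrite cards0 expr0 mul1r; apply: eq_bern_exp => B; rewrite finset.sub0set mul1r.
have fi B : f (B :\ i) = f B.
  rewrite -fS -[RHS]fS; congr f; apply/finset.setP => j; rewrite !inE.
  by case: eqP => [->|]; rewrite ?iS.
have cS : #|S| = #|S :\ i|.+1 by rewrite (cardsD1 i S) iS.
rewrite cS exprS -mulrA -IH; last first.
- move=> B; rewrite -[RHS]fS -[LHS]fS; congr f; apply/finset.setP => j; rewrite !inE.
  by case: (j \in S); rewrite ?andbF ?orbT.
- by rewrite -ltnS -cS.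
rewrite -(@bern_exp_mem p i) => [|B].
  apply: eq_bern_exp => B; rewrite mulrA -natrM mulnb; congr (_%:R * _).
  by rewrite -{1}(finset.setD1K iS) finset.subUset finset.sub1set.
rewrite fi; congr (_%:R * _); congr nat_of_bool.
by rewrite subsetD1 !inE eqxx andbT.
Qed.

Lemma bern_prob_subset p S : bern_prob p (fun B => S \subset B) = p ^+ #|S|.
Proof.
rewrite -[RHS]mulr1 -[X in _ * X](bern_exp_cst p) -bern_exp_subset //.
by apply: eq_bern_exp => B; rewrite mulr1.
Qed.

Lemma le_bern_prob p (E F : pred {set T}) : 0 <= p <= 1 ->
  (forall B, E B -> F B) -> bern_prob p E <= bern_prob p F.
Proof.
move=> p01 EF; apply: le_bern_exp => // B; rewrite ler_nat.
by case EB: (E B) => //; rewrite EF.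
Qed.

Lemma bern_prob_has p (V : eqType) (E : V -> pred {set T}) (l : seq V) :
  0 <= p <= 1 ->
  bern_prob p (fun B => has (E^~ B) l) <= \sum_(v <- l) bern_prob p (E v).
Proof.
move=> p01; rewrite -bern_exp_sum; apply: le_bern_exp => // B.
elim: l => [|v l IH]; first by rewrite big_nil.
rewrite big_cons /=; case: (E v B) => /=; last by rewrite add0r.
by rewrite lerDl sumr_ge0.
Qed.

(** Chebyshev's inequality for the binomial variable [#|B|]. *)
Lemma bern_prob_card p (a : R) (E : pred {set T}) : 0 <= p <= 1 -> 0 < a ->
  (forall B, E B -> a <= `|#|B|%:R - #|T|%:R * p|) ->
  bern_prob p E <= #|T|%:R * p / a ^+ 2.
Proof.
move=> p01 a0 Ea.
have cardE B : #|B|%:R = \sum_i (i \in B)%:R :> R.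
  by rewrite -sum1_card natr_sum big_mkcond; apply: eq_bigr => i _; case: ifP.
have memE i : bern_exp p (fun B => (i \in B)%:R) = p.
  rewrite -[RHS]expr1 -(cards1 i) -bern_prob_subset.
  by apply: eq_bern_exp => B; rewrite finset.sub1set.
(* First and second moments of #|B|, written as a sum of indicators. *)
have m1 : bern_exp p (fun B => #|B|%:R) = #|T|%:R * p.
  rewrite (eq_bern_exp _ cardE) bern_exp_sum (eq_bigr (fun=> p)) => [|i _].
    by rewrite sumr_const mulr_natl.
  exact: memE.
have m2 : bern_exp p (fun B => #|B|%:R ^+ 2) =
    #|T|%:R * p + #|T|%:R * (#|T|%:R - 1) * p ^+ 2.
  rewrite (@eq_bern_exp _ _ (fun B => \sum_i \sum_j ((i \in B) && (j \in B))%:R)).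
    rewrite bern_exp_sum (eq_bigr (fun=> p + (#|T|%:R - 1) * p ^+ 2)) => [|i _].
      by rewrite sumr_const -[LHS]mulr_natl mulrDr mulrA.
    rewrite bern_exp_sum (bigD1 i) //= (eq_bigr (fun=> p ^+ 2)) => [|j ji].
      under eq_bern_exp => B do rewrite andbb.
      rewrite memE sumr_const -[X in _ + X]mulr_natl cardC1.
      by rewrite -subn1 natrB //; apply/card_gt0P; exists i.
    have <- : #|[set i; j]| = 2%N by rewrite cards2 eq_sym ji.
    rewrite -bern_prob_subset; apply: eq_bern_exp => B.
    by rewrite finset.subUset !finset.sub1set.
  move=> B; rewrite cardE expr2 mulr_suml; apply: eq_bigr => i _.
  by rewrite mulr_sumr; apply: eq_bigr => j _; rewrite -natrM mulnb.
have var : bern_exp p (fun B => (#|B|%:R - #|T|%:R * p) ^+ 2) =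
    #|T|%:R * p * (1 - p).
  rewrite (@eq_bern_exp _ _ (fun B => #|B|%:R ^+ 2 +
    (- 2 * (#|T|%:R * p) * #|B|%:R + (#|T|%:R * p) ^+ 2))); last first.
    by move=> B; ring.
  by rewrite !bern_expD bern_expZ bern_exp_cst m1 m2; ring.
rewrite ler_pdivlMr ?exprn_gt0 // mulrC -bern_expZ.
have /andP[p0 p1] := p01.
apply: (@le_trans _ _ (#|T|%:R * p * (1 - p))); last first.
  by rewrite ler_piMr ?mulr_ge0 // gerBl.
rewrite -var; apply: le_bern_exp => // B.
case EB: (E B); rewrite ?mulr0 ?sqr_ge0 // mulr1.
rewrite -[leRHS]real_normK ?num_real // ler_sqr ?nnegrE ?(ltW a0) //.
exact: Ea.
Qed.

End BernoulliSet.

(** * Poisson approximation *)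

(** exp(-q) lies between 1 - q and 1 / (1 + q). *)
Lemma expRN_quadratic (R : realType) (q : R) : 0 <= q ->
  0 <= expR (- q) - (1 - q) <= q ^+ 2.
Proof.
move=> q0; rewrite subr_ge0 expR_ge1Dx /=.
have q1 : 0 < 1 + q by lra.
have : expR (- q) <= (1 + q)^-1.
  by rewrite expRN lef_pV2 ?posrE ?expR_gt0 // expR_ge1Dx.
move=> /le_trans H; rewrite lerBlDr; apply: H.
rewrite invf_ple ?posrE //; last by nra.
rewrite -div1r ler_pdivrMr; nra.
Qed.

Section PoissonApproximation.
Variables (R : realType) (T V : finType) (p : R) (N : V -> {set T}) (s D : nat).
Hypothesis p01 : 0 <= p <= 1.
Hypothesis s_gt0 : (0 < s)%N.
Hypothesis cardN : forall v, #|N v| = s.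
Hypothesis injN : injective N.
Hypothesis overlapN : forall v, (#|[set w | ~~ [disjoint N w & N v]]| <= D)%N.

Let uncovered (l : seq V) (B : {set T}) := ~~ has (fun v => N v \subset B) l.

(** Two distinct sets of size [s] have at least [s + 1] elements together. *)
Let bern_prob_pair v w : v != w ->
  bern_prob p (fun B => (N v \subset B) && (N w \subset B)) <= p ^+ s.+1.
Proof.
move=> vw; have /andP[p0 p1] := p01.
apply: (@le_trans _ _ (bern_prob p (fun B => N v :|: N w \subset B))).
  by apply: le_bern_prob => // B; rewrite finset.subUset.
rewrite bern_prob_subset ler_wiXn2l //.
rewrite -(cardN v) proper_card // finset.properEneq finset.subsetUl andbT.
apply: contra vw => /eqP NvU; apply/eqP/injN/eqP.
by rewrite eq_sym eqEcard !cardN leqnn andbT NvU finset.subsetUr.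
Qed.

(** The one-step recursion.  Let [a] be the probability that [N v] is covered
    but none of the earlier sets.  Keeping only the earlier sets disjoint from
    [N v] makes the two requirements independent; dropping the at most [D]
    others changes [a], and likewise [p ^+ s] times the probability that no
    earlier set is covered, by at most [D * p ^+ s.+1]. *)
Let uncovered_cons v l : uniq (v :: l) ->
  `| bern_prob p (uncovered (v :: l)) - (1 - p ^+ s) * bern_prob p (uncovered l) |
    <= D%:R * p ^+ s.+1.
Proof.
move=> /= /andP[vl ul]; have /andP[p0 p1] := p01.
pose far := [seq w <- l | [disjoint N w & N v]].
pose near := [seq w <- l | ~~ [disjoint N w & N v]].
have size_near : (size near <= D)%N.
  rewrite -(card_uniqP (filter_uniq _ ul)); apply: leq_trans (overlapN v).
  by apply: subset_leq_card; apply/fintype.subsetP => w;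
    rewrite mem_filter inE => /andP[].
have sum_near (F : V -> R) e : (forall w, w \in near -> F w <= e) -> 0 <= e ->
    \sum_(w <- near) F w <= D%:R * e.
  move=> Fe e0; apply: (@le_trans _ _ ((size near)%:R * e)); last first.
    by rewrite ler_wpM2r // ler_nat.
  rewrite -sum1_size natr_sum mulr_suml big_seq [leRHS]big_seq.
  by apply: ler_sum => w wn; rewrite mul1r Fe.
have split_l B : uncovered l B = uncovered far B && uncovered near B.
  rewrite /uncovered -negb_or; congr (~~ _).
  rewrite -has_cat; apply: eq_has_r => w.
  by rewrite mem_cat !mem_filter -andb_orl orbN.
pose a := bern_prob p (fun B => (N v \subset B) && uncovered l B).
have recl : bern_prob p (uncovered (v :: l)) = bern_prob p (uncovered l) - a.
  apply/(canRL (addrK _)); rewrite -bern_expD; apply: eq_bern_exp => B.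
  by rewrite -natrD /uncovered /=; case: (N v \subset B); case: has.
have indep : bern_prob p (fun B => (N v \subset B) && uncovered far B) =
    p ^+ s * bern_prob p (uncovered far).
  rewrite -(cardN v) -bern_exp_subset => [|B].
    by apply: eq_bern_exp => B; rewrite -natrM mulnb.
  congr (nat_of_bool (~~ _))%:R; apply: eq_in_has => w.
  by rewrite mem_filter finset.subsetD => /andP[-> _]; rewrite andbT.
have ps1 : p ^+ s.+1 <= p ^+ s by rewrite ler_wiXn2l.
have ub : a <= p ^+ s * (bern_prob p (uncovered l) + D%:R * p ^+ s).
  apply: (@le_trans _ _ (p ^+ s * bern_prob p (uncovered far))).
    by rewrite -indep; apply: le_bern_prob => // B; rewrite split_l;
      case/and3P=> -> ->.
  rewrite ler_wpM2l ?exprn_ge0 //.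
  apply: (@le_trans _ _ (bern_prob p (uncovered l) +
      bern_prob p (fun B => has (fun w => N w \subset B) near))).
    rewrite -bern_expD; apply: le_bern_exp => // B; rewrite split_l -natrD ler_nat.
    by rewrite /uncovered; case: (has _ far) => //; case: (has _ near).
  rewrite lerD2l; apply: le_trans (bern_prob_has (fun w B => N w \subset B) _ p01) _.
  apply: sum_near => [w _|]; last by rewrite exprn_ge0.
  by rewrite bern_prob_subset cardN.
have lb : p ^+ s * bern_prob p (uncovered l) <= a + D%:R * p ^+ s.+1.
  apply: (@le_trans _ _ (p ^+ s * bern_prob p (uncovered far))).
    rewrite ler_wpM2l ?exprn_ge0 //; apply: le_bern_prob => // B.
    by rewrite split_l => /andP[].
  rewrite -indep; apply: (@le_trans _ _ (a +
    bern_prob p (fun B => has (fun w => (N v \subset B) && (N w \subset B)) near))).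
    rewrite -bern_expD; apply: le_bern_exp => // B; rewrite split_l -natrD ler_nat.
    case: (N v \subset B) => //=; rewrite /uncovered.
    by case: (has _ far) => //; case: (has _ near).
  rewrite lerD2l.
  apply: le_trans (bern_prob_has (fun w B => (N v \subset B) && (N w \subset B)) _ p01) _.
  apply: sum_near => [w|]; last by rewrite exprn_ge0.
  rewrite mem_filter => /andP[_ wl]; apply: bern_prob_pair.
  by apply: contraNneq vl => ->.
have p2s : p ^+ s * p ^+ s <= p ^+ s.+1.
  by rewrite -exprD ler_wiXn2l //; lia.
have D0 : 0 <= D%:R :> R by [].
rewrite recl ler_norml; apply/andP; split; nra.
Qed.

(** Replacing the factor 1 - p^s of the recursion by exp(-p^s) costs p^(2s) per
    step, which accounts for the passage from [D] to [D.+1]; since both factors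
    are at most 1, the errors add up. *)
Lemma bern_prob_uncovered :
  `| bern_prob p (fun B => [forall v, ~~ (N v \subset B)])
     - expR (- (#|V|%:R * p ^+ s)) | <= #|V|%:R * (D.+1%:R * p ^+ s.+1).
Proof.
have /andP[p0 p1] := p01.
have -> : bern_prob p (fun B => [forall v, ~~ (N v \subset B)]) =
    bern_prob p (uncovered (enum V)).
  apply: eq_bern_exp => B; congr (nat_of_bool _)%:R.
  apply/forallP/hasPn => H v; last exact/H/mem_enum.
  by move=> _; apply: H.
rewrite cardE; elim: (enum V) (enum_uniq V) => [_|v l IH uvl].
  rewrite /= !mul0r oppr0 expR0.
  have -> : bern_prob p (uncovered [::]) = 1 := bern_exp_cst T p 1.
  by rewrite subrr normr0.
have /= /andP[_ ul] := uvl.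
have step := uncovered_cons uvl; have {IH}IH := IH ul.
have [t0 t1] := andP (expRN_quadratic (exprn_ge0 s p0)).
have P1 : p ^+ s <= 1 by rewrite exprn_ile1.
have P0 : 0 <= p ^+ s by rewrite exprn_ge0.
have p2s : (p ^+ s) ^+ 2 <= p ^+ s.+1.
  by rewrite -exprM ler_wiXn2l //; lia.
have -> : - ((size (v :: l))%:R * p ^+ s) = - p ^+ s - (size l)%:R * p ^+ s.
  by rewrite /= -add1n natrD; ring.
rewrite expRD; set e := expR _ in t0 t1 *; set E := expR _ in IH *.
have E1 : E <= 1 by rewrite /E -expR0 ler_expR oppr_le0 mulr_ge0.
have E0 : 0 <= E by rewrite expR_ge0.
have S1 k : k.+1%:R = 1 + k%:R :> R by rewrite -add1n natrD.
rewrite /= [in leRHS]S1 mulrDl mul1r.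
set q' := bern_prob p (uncovered (v :: l)) in step *.
set q := bern_prob p (uncovered l) in step IH *.
(* Defect of the recursion, previous error, and exp(-p^s) - (1 - p^s). *)
have -> : q' - e * E = (q' - (1 - p ^+ s) * q) + (1 - p ^+ s) * (q - E)
    - (e - (1 - p ^+ s)) * E by ring.
apply: le_trans (ler_normB _ _) _.
rewrite addrC; apply: (@le_trans _ _ (p ^+ s.+1 + (D%:R * p ^+ s.+1 + `|q - E|))).
  apply: lerD.
    by rewrite normrM !ger0_norm //; nra.
  apply: le_trans (ler_normD _ _) _; apply: lerD => //.
  rewrite normrM ger0_norm ?subr_ge0 //.
  by rewrite ler_piMl // gerBl.
by rewrite addrA -[X in X + _ + _]mul1r -mulrDl -S1 lerD2l.
Qed.

End PoissonApproximation.

(** * From independent elements to sets of fixed size *)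

Section Depoissonization.
Variables (R : realType) (T : finType).
Implicit Types (p : R) (B C : {set T}) (f : {set T} -> R).

(** List both sets, each followed by its complement, and match the lists. *)
Lemma perm_imset_card B C : #|B| = #|C| -> exists t : {perm T}, t @: C = B.
Proof.
move=> BC.
pose L (A : {set T}) := enum A ++ enum (~: A).
have memL A x : x \in L A.
  by rewrite mem_cat !mem_enum inE orbN.
have uniqL A : uniq (L A).
  rewrite cat_uniq !enum_uniq andbT /=; apply/hasPn => x.
  by rewrite !mem_enum inE.
have sizeL A : size (L A) = #|T|.
  by rewrite size_cat -!cardE cardsC.
have ltL x : (index x (L C) < size (L B))%N.
  by rewrite sizeL -(sizeL C) index_mem memL.
pose t x := nth x (L B) (index x (L C)).
have inj_t : injective t.
  move=> x y; rewrite /t (set_nth_default x) // => /eqP.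
  rewrite nth_uniq // => /eqP; exact: index_inj.
exists (perm inj_t); apply/eqP; rewrite eqEcard BC.
rewrite [X in (_ <= X)%N]card_imset ?leqnn ?andbT; last exact: perm_inj.
apply/fintype.subsetP => _ /imsetP [x xC ->]; rewrite permE /t.
have iC : (index x (L C) < #|C|)%N.
  by rewrite index_cat mem_enum xC cardE index_mem mem_enum.
by rewrite nth_cat -cardE BC iC -mem_enum mem_nth // -cardE BC.
Qed.

Definition perm_avg f B : R := (\sum_(s : {perm T}) f (s @: B)) / (#|T|)`!%:R.

Lemma card_perm_type : #|{perm T}| = (#|T|)`!.
Proof.
rewrite -(cardsT T) -card_perm; apply: eq_card => s; rewrite !inE.
by apply/esym/fintype.subsetP => x; rewrite inE.
Qed.

Lemma perm_avg_card f B C : #|B| = #|C| -> perm_avg f B = perm_avg f C.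
Proof.
case/perm_imset_card => t <-; congr (_ / _).
rewrite [RHS](reindex_inj (mulgI t)); apply: eq_bigr => s _.
by rewrite -imset_comp; congr f; apply: eq_imset => x /=; rewrite permM.
Qed.

Lemma bern_exp_perm p f (s : {perm T}) :
  bern_exp p (fun B => f (s @: B)) = bern_exp p f.
Proof.
rewrite [RHS](reindex_inj (imset_inj (@perm_inj _ s))).
apply: eq_bigr => B _; congr (_ * _); rewrite /bern_weight.
rewrite card_imset; last exact: perm_inj.
congr (_ * _ ^+ _); apply/eqP; rewrite -(eqn_add2l #|B|) cardsC.
rewrite -[X in (_ == X + _)%N](card_imset (mem B) (@perm_inj _ s)).
by rewrite cardsC.
Qed.

(** The Bernoulli weights are invariant under relabelling.  Together with
    [perm_avg_card], this writes an expectation as a binomial mixture of uniform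
    averages over sets of given sizes. *)
Lemma bern_exp_avg p f : bern_exp p f = bern_exp p (perm_avg f).
Proof.
under [RHS]eq_bern_exp => B do rewrite /perm_avg mulrC.
rewrite bern_expZ bern_exp_sum.
under eq_bigr => s _ do rewrite bern_exp_perm.
by rewrite sumr_const -[X in _ * X]mulr_natl card_perm_type mulKf.
Qed.

Section Monotone.
Variables (p : R) (f : {set T} -> R).
Hypothesis p01 : 0 <= p <= 1.
Hypothesis f01 : forall B, 0 <= f B <= 1.
Hypothesis f_mono : forall A B : {set T}, A \subset B -> f A <= f B.

Let perm_avg01 B : 0 <= perm_avg f B <= 1.
Proof.
rewrite divr_ge0 ?sumr_ge0 //=; last by move=> s _; case/andP: (f01 (s @: B)).
rewrite ler_pdivrMr ?ltr0n ?fact_gt0 // mul1r -card_perm_type -sum1_card natr_sum.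
by apply: ler_sum => s _; case/andP: (f01 (s @: B)).
Qed.

(** By [perm_avg_card] the smaller set may be taken inside the larger one. *)
Let perm_avg_mono B C : (#|B| <= #|C|)%N -> perm_avg f B <= perm_avg f C.
Proof.
move=> BC.
have /card_geqP [l [ul sl lC]] := BC.
have <- : perm_avg f [set x in l] = perm_avg f B.
  by apply: perm_avg_card; rewrite cardsE (card_uniqP ul).
rewrite ler_wpM2r ?invr_ge0 //; apply: ler_sum => s _; apply: f_mono.
by apply: imsetS; apply/fintype.subsetP => x; rewrite inE => /lC.
Qed.

(** Sets with at least as many elements as [B] contribute at least the average
    over the relabellings of [B]; the remaining ones are paid for in full. *)
Lemma perm_avg_le B :
  perm_avg f B <= bern_exp p f + bern_prob p (fun A : {set T} => (#|A| < #|B|)%N).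
Proof.
rewrite bern_exp_avg -bern_expD -[leLHS](bern_exp_cst T p).
apply: le_bern_exp => // A; case: ltnP => AB /=.
  case/andP: (perm_avg01 A) => A0 _; case/andP: (perm_avg01 B) => _ B1.
  by rewrite (le_trans B1) // lerDr.
by rewrite addr0 perm_avg_mono.
Qed.

Lemma perm_avg_ge B :
  bern_exp p f <= perm_avg f B + bern_prob p (fun A : {set T} => (#|B| < #|A|)%N).
Proof.
rewrite bern_exp_avg -[X in X + _](bern_exp_cst T p) -bern_expD.
apply: le_bern_exp => // A; case: ltnP => AB /=.
  case/andP: (perm_avg01 A) => _ A1; case/andP: (perm_avg01 B) => B0 _.
  by rewrite (le_trans A1) // lerDr.
by rewrite addr0 perm_avg_mono.
Qed.

End Monotone.

End Depoissonization.

(** * Bounds for the tail of K *)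

Section SurvivalBounds.
Variables (R : realType) (n d : nat).
Hypothesis d_gt0 : (0 < d)%N.
Hypothesis n_large : (4 * d < n)%N.
Implicit Types (p x y z : R) (B : {set 'I_n}).

Definition survival (k : nat) : R :=
  #|[set s : ordering n | (k < K d s)%N]|%:R / n`!%:R.

Let nlt : (2 * d < n)%N. Proof. by lia. Qed.

Let covers (N : 'I_n -> {set 'I_n}) B : R := [exists v, N v \subset B]%:R.

Let covers01 N B : 0 <= covers N B <= 1.
Proof. by rewrite /covers ler0n (ler_nat _ _ 1) leq_b1. Qed.

Let covers_mono N (A B : {set 'I_n}) : A \subset B -> covers N A <= covers N B.
Proof.
move=> AB; rewrite ler_nat; case: existsP => // -[v vA].
suff -> : [exists v, N v \subset B] by [].
by apply/existsP; exists v; exact: fintype.subset_trans vA AB.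
Qed.

Let none p :=
  bern_prob p (fun B => [forall v, ~~ (nbhd d v \subset B)]).

Let bern_exp_covers p : bern_exp p (covers (@nbhd n d)) = 1 - none p.
Proof.
apply/(canRL (addrK _)); rewrite -bern_expD -[RHS](bern_exp_cst 'I_n p).
apply: eq_bern_exp => B; rewrite -natrD /covers -negb_exists.
by case: [exists _, _].
Qed.

Let survivalE k : survival k =
  (\sum_(s : {perm 'I_n}) (k < K d s)%N%:R) / (#|'I_n|)`!%:R.
Proof.
rewrite card_ord /survival -sum1_card natr_sum big_mkcond; congr (_ / _).
by apply: eq_bigr => s _; rewrite inE; case: ifP.
Qed.

Let avg1 : 1 = (\sum_(s : {perm 'I_n}) 1) / (#|'I_n|)`!%:R :> R.
Proof.
rewrite sumr_const card_perm_type divff // pnatr_eq0 -lt0n; exact: fact_gt0.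
Qed.

(** If no neighbourhood lies among the last k vertices then K > k. *)
Let survival_ge k : (k < n)%N ->
  1 - perm_avg (covers (@nbhd n d)) (last_positions n k) <= survival k.
Proof.
move=> kn; rewrite lerBlDr survivalE -mulrDl -big_split [leLHS]avg1 /=.
rewrite ler_wpM2r ?invr_ge0 //; apply: ler_sum => s _.
rewrite /covers -natrD (ler_nat _ 1); case: (ltnP k (K d s)) => //= Ks.
by rewrite (K_le_covered kn Ks).
Qed.

(** If K > k, a neighbourhood among the last k vertices can only be that of a
    vertex which is itself one of them. *)
Let survival_le k :
  survival k <= 1 - perm_avg (covers (@nbhd n d)) (last_positions n k)
    + perm_avg (covers (@closed_nbhd n d)) (last_positions n k).
Proof.
rewrite addrAC lerBrDr [X in _ <= X + _]avg1 survivalE -!mulrDl -!big_split /=.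
rewrite ler_wpM2r ?invr_ge0 //; apply: ler_sum => s _.
rewrite /covers -natrD -(natrD _ 1) ler_nat; case: (ltnP k (K d s)) => /= [kK|_]; last first.
  by rewrite add0n; case: [exists _, _].
case: existsP => //= -[v vs].
suff -> : [exists v, closed_nbhd d v \subset s @: last_positions n k].
  by rewrite addn1.
apply/existsP; exists v; rewrite /closed_nbhd finset.subUset vs andbT finset.sub1set.
by apply: contraLR kK => vB; rewrite -leqNgt; apply: covered_K_le vs vB.
Qed.

(* Probabilities are taken of the form y * r with r = n^(-1/2d), so that the
   expected number n * (y * r)^(2d) of covered neighbourhoods is y^(2d); then
   b = n * r = n^(1-1/2d) is the scale of K. *)
Variable r : R.
Hypothesis r_gt0 : 0 < r.
Hypothesis r_le1 : r <= 1.
Hypothesis nr : n%:R * r ^+ (2 * d) = 1.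

Let b := n%:R * r.

Let n_gt0 : 0 < n%:R :> R.
Proof. by rewrite ltr0n; lia. Qed.

Let b_gt0 : 0 < b. Proof. by rewrite mulr_gt0. Qed.

Let invb_le : b^-1 <= r.
Proof.
have -> : b^-1 = r ^+ (2 * d).-1.
  apply: (mulfI (lt0r_neq0 b_gt0)); rewrite divff ?lt0r_neq0 //.
  by rewrite -[1]nr /b -mulrA -exprS prednK //; lia.
by rewrite -[leRHS]expr1 ler_wiXn2l ?(ltW r_gt0) //; lia.
Qed.

(** The constant of the Poisson approximation at density y * r: the error
    n * (D + 1) * (y * r)^(2d+1), with D = (2d)^2, equals [clumps y * r]. *)
Definition clumps y : R := ((2 * d) * (2 * d)).+1%:R * y ^+ (2 * d).+1.

Let none_approx y : 0 < y -> y * r <= 1 ->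
  `| none (y * r) - expR (- y ^+ (2 * d)) | <= clumps y * r.
Proof.
move=> y0 yr1.
have p01 : 0 <= y * r <= 1 by rewrite yr1 mulr_ge0 ?ltW.
have := @bern_prob_uncovered R 'I_n 'I_n (y * r) (@nbhd n d) (2 * d)
  (2 * d * (2 * d)) p01 _ _ (nbhd_inj d_gt0 n_large) _.
rewrite card_ord exprMn mulrCA nr mulr1 -/(none _).
rewrite [X in _ -> _ -> _ -> _ <= X](_ : _ = clumps y * r); last first.
  rewrite /clumps !exprMn [r ^+ _.+1]exprS.
  rewrite -[RHS]mulr1 -[X in _ = _ * X]nr; ring.
apply; [lia | | ] => v; [exact: card_nbhd|exact: nbhd_overlap].
Qed.

(** Chebyshev's bound is y / (delta^2 * b), and 1 / b = r^(2d-1) <= r. *)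
Let card_tail y delta (E : pred {set 'I_n}) : 0 < y -> y * r <= 1 -> 0 < delta ->
  (forall B, E B -> delta * b <= `|#|B|%:R - y * b|) ->
  bern_prob (y * r) E <= y / delta ^+ 2 * r.
Proof.
move=> y0 yr1 de0 EB.
have p01 : 0 <= y * r <= 1 by rewrite yr1 mulr_ge0 ?ltW.
have db : 0 < delta * b by rewrite mulr_gt0.
have ny : n%:R * (y * r) = y * b by rewrite mulrCA.
have := @bern_prob_card R 'I_n (y * r) _ E p01 db.
rewrite card_ord ny => /(_ EB) /le_trans -> //.
have -> : y * b / (delta * b) ^+ 2 = y / delta ^+ 2 * b^-1.
  by field; rewrite !lt0r_neq0.
by rewrite ler_wpM2l // mulr_ge0 ?(ltW y0) // invr_ge0 exprn_ge0 ?(ltW de0).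
Qed.

Let k_lt_n x z (k : nat) : x < z -> z * r <= 1 -> k%:R <= x * b -> (k < n)%N.
Proof.
move=> xz zr1 kx; rewrite -(ltr_nat R); apply: le_lt_trans kx _.
apply: (@lt_le_trans _ _ (z * b)); first by rewrite ltr_pM2r.
by rewrite /b mulrCA ler_piMr ?(ltW n_gt0).
Qed.

Let card_last k : (k < n)%N -> #|last_positions n k| = k.
Proof. by move=> kn; rewrite card_last_positions // ltnW. Qed.

Let few_removed x z (k : nat) : 0 < x -> x < z -> z * r <= 1 -> k%:R <= x * b ->
  bern_prob (z * r) (fun A : {set 'I_n} => (#|A| < #|last_positions n k|)%N)
    <= z / (z - x) ^+ 2 * r.
Proof.
move=> x0 xz zr1 kx; have kn := k_lt_n xz zr1 kx.
apply: card_tail => //; first exact: lt_trans xz.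
  by rewrite subr_gt0.
move=> A; rewrite card_last // => Ak.
rewrite distrC; apply: le_trans (ler_norm _).
rewrite mulrBl lerD2l lerN2; apply: le_trans kx.
by rewrite ler_nat ltnW.
Qed.

(** Comparison with the density y * r > k / n. *)
Lemma survival_lower x y (k : nat) : 0 < x -> x < y -> y * r <= 1 ->
  k%:R <= x * b ->
  expR (- y ^+ (2 * d)) - (clumps y + y / (y - x) ^+ 2) * r <= survival k.
Proof.
move=> x0 xy yr1 kx; have y0 : 0 < y := lt_trans x0 xy.
have kn := k_lt_n xy yr1 kx.
have p01 : 0 <= y * r <= 1 by rewrite yr1 mulr_ge0 ?ltW.
apply: le_trans (survival_ge kn).
have := perm_avg_le p01 (covers01 _) (@covers_mono _) (last_positions n k).
move=> /(_ (@nbhd n d)); rewrite bern_exp_covers.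
have := few_removed x0 xy yr1 kx.
have := none_approx y0 yr1; rewrite ler_norml => /andP[+ _].
rewrite mulrDl; lra.
Qed.

(** The density y * r < (k + 1) / n controls the neighbourhoods; the density
    z * r > k / n controls the closed neighbourhoods, of which the expected
    number n * (z * r)^(2d+1) equals z^(2d+1) * r. *)
Lemma survival_upper x y z (k : nat) : 0 < y -> y < x -> x < z -> z * r <= 1 ->
  k%:R <= x * b < k.+1%:R ->
  survival k <= expR (- y ^+ (2 * d))
    + (clumps y + y / (x - y) ^+ 2 + z ^+ (2 * d).+1 + z / (z - x) ^+ 2) * r.
Proof.
move=> y0 yx xz zr1 /andP[kx xk].
have x0 : 0 < x := lt_trans y0 yx; have z0 : 0 < z := lt_trans x0 xz.
have kn := k_lt_n xz zr1 kx.
have yr1 : y * r <= 1.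
  by apply: le_trans zr1; rewrite ler_wpM2r ?ltW // (lt_trans yx).
have y01 : 0 <= y * r <= 1 by rewrite yr1 mulr_ge0 ?ltW.
have z01 : 0 <= z * r <= 1 by rewrite zr1 mulr_ge0 ?ltW.
apply: le_trans (survival_le k) _.
have H1 := perm_avg_ge y01 (covers01 (@nbhd n d)) (@covers_mono _) (last_positions n k).
have H2 := perm_avg_le z01 (covers01 (@closed_nbhd n d)) (@covers_mono _) (last_positions n k).
rewrite bern_exp_covers in H1.
have H3 := few_removed x0 xz zr1 kx.
have H4 : bern_prob (y * r) (fun A : {set 'I_n} => (#|last_positions n k| < #|A|)%N)
    <= y / (x - y) ^+ 2 * r.
  apply: card_tail => //; first by rewrite subr_gt0.
  move=> A; rewrite card_last // => kA.
  apply: le_trans (ler_norm _); rewrite mulrBl lerD2r.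
  by apply: le_trans (ltW xk) _; rewrite ler_nat.
have cardC (v : 'I_n) : #|closed_nbhd d v| = (2 * d).+1 by exact: card_closed_nbhd nlt.
have H5 : bern_exp (z * r) (covers (@closed_nbhd n d)) <= z ^+ (2 * d).+1 * r.
  have probC (v : 'I_n) : bern_prob (z * r) (fun B => closed_nbhd d v \subset B) =
      (z * r) ^+ (2 * d).+1 by rewrite -(cardC v); exact: bern_prob_subset.
  have := bern_prob_has (fun v B => closed_nbhd d v \subset B) (enum 'I_n) z01.
  rewrite (eq_bigr _ (fun v _ => probC v)) big_enum /= sumr_const card_ord.
  rewrite -[_ *+ _]mulr_natl => /(le_trans _) H; apply: le_trans (H _ _) _.
    apply: le_bern_exp => // B; rewrite ler_nat.
    case: existsP => // -[v vB].
    suff -> : has (fun v => closed_nbhd d v \subset B) (enum 'I_n) by [].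
    by apply/hasP; exists v => //; rewrite mem_enum.
  rewrite exprMn [r ^+ _.+1]exprS -[leRHS]mulr1 -[X in _ <= _ * X]nr.
  by rewrite le_eqVlt; apply/orP; left; apply/eqP; ring.
have := none_approx y0 yr1; rewrite ler_norml => /andP[_ H6].
rewrite !mulrDl; lra.
Qed.

End SurvivalBounds.

Local Open Scope classical_set_scope.
Local Open Scope ring_scope.

(** * A variable with the Weibull law *)

Section WeibullVariable.
Variables (R : realType) (m : nat).

(** The shape is [m.+1] because a positive shape is needed for the limit at
    infinity to be 1, and the instances below take no hypotheses. *)
Definition weibull_cdf (x : R) : R := 1 - expR (- Num.max x 0 ^+ m.+1).

Lemma weibull_cdf_neg x : x <= 0 -> weibull_cdf x = 0.
Proof.
by move=> x0; rewrite /weibull_cdf max_r // expr0n oppr0 expR0 subrr.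
Qed.

Lemma weibull_cdf_pos x : 0 <= x -> weibull_cdf x = 1 - expR (- x ^+ m.+1).
Proof. by move=> x0; rewrite /weibull_cdf max_l. Qed.

Let weibull_cdf_nd : nondecreasing weibull_cdf.
Proof.
have max0 (z : R) : Num.max z 0 \is Num.nneg by rewrite nnegrE le_max lexx orbT.
move=> x y xy; rewrite lerB // ler_expR lerN2; apply: lerXn2r => //.
by rewrite ge_max !le_max xy lexx orbT.
Qed.

Lemma continuous_expRNX k : continuous (fun x : R => expR (- x ^+ k)).
Proof.
move=> x; apply: continuous_comp; last exact: continuous_expR.
by apply: (@continuousN _ R^o); exact: exprn_continuous.
Qed.

Let weibull_cdf_rc : right_continuous weibull_cdf.
Proof.
move=> x; apply: cvg_at_right_filter; apply: (@cvgB _ R^o); first exact: cvg_cst.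
have cmax : {for x, continuous (fun y : R^o => Num.max y 0 : R^o)}.
  by apply: continuous_max; [exact: cvg_id|exact: cvg_cst].
exact: (@continuous_comp R R R (fun y : R => Num.max y 0)
  (fun y : R => expR (- y ^+ m.+1)) x cmax (@continuous_expRNX _ _)).
Qed.

HB.instance Definition _ :=
  isCumulative.Build R _ R weibull_cdf weibull_cdf_nd weibull_cdf_rc.

Let weibull_cdfNy : weibull_cdf @ -oo --> (0 : R).
Proof.
apply: cvg_near_cst; near=> x; apply: weibull_cdf_neg.
by near: x; apply: nbhs_ninfty_le; exact: num_real.
Unshelve. all: by end_near. Qed.

Let weibull_cdfy : weibull_cdf @ +oo --> (1 : R).
Proof.
rewrite -[X in _ --> X]subr0; apply: (@cvgB _ R^o); first exact: cvg_cst.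
apply: (@squeeze_cvgr _ _ _ _ (cst 0) (fun x => expR (- x))).
- near=> x.
  have x1 : 1 <= x by near: x; apply: nbhs_pinfty_ge; exact: num_real.
  rewrite expR_ge0 ler_expR lerN2 max_l ?(le_trans ler01) //.
  by rewrite exprS ler_peMr ?(le_trans ler01) // exprn_ege1.
- exact: cvg_cst.
- exact: cvgr_expR.
Unshelve. all: by end_near. Qed.

HB.instance Definition _ :=
  isCumulativeBounded.Build R 0 1 weibull_cdf weibull_cdfNy weibull_cdfy.

Definition weibull_measure : probability (measurableTypeR R) R :=
  lebesgue_stieltjes_measure weibull_cdf.

Definition weibull_variable : measurableTypeR R -> R := idfun.

HB.instance Definition _ := @isMeasurableFun.Build _ _ _ _ weibull_variable
  (@measurable_id _ _ setT).

Lemma cdf_weibull x :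
  cdf (weibull_variable : {RV weibull_measure >-> R}) x = (weibull_cdf x)%:E.
Proof. exact: (cdf_lebesgue_stieltjes_id weibull_cdf). Qed.

Lemma ccdf_weibull x : 0 <= x ->
  ccdf (weibull_variable : {RV weibull_measure >-> R}) x =
  (expR (- x ^+ m.+1))%:E.
Proof.
move=> x0; rewrite ccdf_1_cdf cdf_weibull weibull_cdf_pos //.
by rewrite -EFinB subKr.
Qed.

End WeibullVariable.

(** * Uniform orderings and the limit *)

Section UniformOrdering.
Variables (R : realType) (disp : measure_display) (T : measurableType disp).
Variables (P : probability T R) (n : nat) (pi : {RV P >-> ordering n}).
Hypothesis pi_unif : uniform_ordering pi.

Lemma uniform_orderingE (A : {set ordering n}) :
  distribution P pi [set s | s \in A] = (#|A|%:R / n`!%:R)%:E.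
Proof.
have -> : [set s | s \in A] = [set s | s \in enum A].
  by apply/seteqP; split => s /=; rewrite mem_enum.
rewrite cardE; elim: (enum A) (enum_uniq A) => [_|s l IH /= /andP[sl ul]].
  rewrite (_ : [set s | s \in [::]] = set0) ?measure0 ?mul0r //.
  by apply/seteqP; split.
have -> : [set s0 | s0 \in s :: l] = [set s] `|` [set s0 | s0 \in l].
  apply/seteqP; split => t /=; rewrite inE.
    by case/orP => [/eqP|]; [left|right].
  by case=> [->|->]; rewrite ?eqxx ?orbT.
transitivity (distribution P pi [set s]
    + distribution P pi [set s0 | s0 \in l])%E.
  rewrite -measureU //.
  by apply/seteqP; split => // t [/= ->]; rewrite (negPf sl).
by rewrite pi_unif IH // -EFinD /= -[in RHS](add1n (size l)) natrD mulrDl mul1r.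
Qed.

End UniformOrdering.

Section Limit.
Variables (R : realType) (d : nat).
Hypothesis d_gt0 : (0 < d)%N.

(** The inclusion probability at which 2d given vertices are all included with
    probability exactly 1 / n. *)
Definition density (n : nat) : R := n%:R `^ (- ((2 * d)%N%:R)^-1).

Lemma density_gt0 n : (0 < n)%N -> 0 < density n.
Proof. by move=> n0; rewrite powR_gt0 // ltr0n. Qed.

Let d2 : ((2 * d)%N%:R : R) != 0.
Proof. by rewrite pnatr_eq0; lia. Qed.

Lemma densityX n : (0 < n)%N -> n%:R * density n ^+ (2 * d) = 1.
Proof.
move=> n0; have n0' : (n%:R : R) != 0 by rewrite pnatr_eq0 -lt0n.
rewrite -powR_mulrn ?powR_ge0 // -powRrM mulNr mulVf //.
by rewrite powR_inv1 ?divff.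
Qed.

Lemma powR_density n : (0 < n)%N ->
  n%:R `^ (1 - ((2 * d)%N%:R)^-1) = n%:R * density n :> R.
Proof.
move=> n0; have n0' : (n%:R : R) != 0 by rewrite pnatr_eq0 -lt0n.
by rewrite powRD ?n0' ?implybT // powRr1.
Qed.

Lemma density_small (e : R) : 0 < e -> \forall n \near \oo, density n <= e.
Proof.
move=> e0; near=> n.
have n0 : (0 < n)%N by near: n; exists 1%N.
rewrite leNgt; apply/negP => er.
have : (1 : R) < n%:R * density n ^+ (2 * d).
  have ne : (e ^+ (2 * d))^-1 <= n%:R by near: n; exact: nbhs_infty_ger.
  apply: (@le_lt_trans _ _ (n%:R * e ^+ (2 * d))).
    by rewrite -ler_pdivrMr ?div1r // exprn_gt0.
  rewrite ltr_pM2l ?ltr0n // ltrXn2r ?nnegrE ?(ltW e0) ?powR_ge0 //.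
  by lia.
by rewrite densityX // ltxx.
Unshelve. all: by end_near. Qed.

(** The bounds [survival_lower] and [survival_upper] at y = x + h and y = x - h:
    the main terms are close to exp(-x^(2d)) by continuity, and for fixed h the
    errors are O(density n). *)
Lemma survival_cvg (x : R) : 0 < x ->
  survival R n d (Num.trunc (x * (n%:R * density n))) @[n --> \oo] -->
  expR (- x ^+ (2 * d)).
Proof.
move=> x0; apply/(@cvgrPdist_le _ R^o) => e e0.
have e20 : 0 < e / 2 by rewrite divr_gt0.
have /(@cvgrPdist_le _ R^o) /(_ _ e20) := @continuous_expRNX R (2 * d) x.
move=> /nbhs_ballP [del /= del0 cont].
pose h := Num.min del x / 2.
have h0 : 0 < h by rewrite divr_gt0 // lt_min del0.
have hx : h < x.
  rewrite ltr_pdivrMr //; apply: (@le_lt_trans _ _ x); last by lra.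
  by rewrite ge_min lexx orbT.
have hdel : h < del.
  rewrite ltr_pdivrMr //; apply: (@le_lt_trans _ _ del); last by lra.
  by rewrite ge_min lexx.
set y1 := x - h; set y2 := x + h.
have c1 : `|expR (- x ^+ (2 * d)) - expR (- y1 ^+ (2 * d))| <= e / 2.
  by apply: cont; rewrite /ball /= /y1 subKr gtr0_norm.
have c2 : `|expR (- x ^+ (2 * d)) - expR (- y2 ^+ (2 * d))| <= e / 2.
  by apply: cont; rewrite /ball /= /y2 opprD addrA subrr sub0r normrN gtr0_norm.
have y1x : y1 < x by rewrite /y1; lra.
have xy2 : x < y2 by rewrite /y2; lra.
have y10 : 0 < y1 by rewrite /y1; lra.
clearbody y1 y2; clear h h0 hx hdel.
have y20 : 0 < y2 by exact: lt_trans xy2.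
have [C1 C1E] : exists C, C = clumps d y1 + y1 / (x - y1) ^+ 2
    + y2 ^+ (2 * d).+1 + y2 / (y2 - x) ^+ 2 by eexists.
have [C2 C2E] : exists C, C = clumps d y2 + y2 / (y2 - x) ^+ 2 by eexists.
have clumps_ge0 y : 0 < y -> 0 <= clumps d y.
  by move=> yy; rewrite mulr_ge0 // exprn_ge0 ?ltW.
have [y1ge y2ge] := (ltW y10, ltW y20).
have C20 : 0 <= C2.
  by rewrite C2E addr_ge0 ?clumps_ge0 ?divr_ge0 ?sqr_ge0 //.
have C10 : 0 <= C1.
  by rewrite C1E !addr_ge0 ?clumps_ge0 ?divr_ge0 ?sqr_ge0 ?exprn_ge0.
near=> n.
have n0 : (0 < n)%N by near: n; exists 1%N.
have nd : (4 * d < n)%N by near: n; exists (4 * d).+1.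
have r0 := density_gt0 n0.
have r1 : density n <= 1 by near: n; apply: density_small.
have yr : y2 * density n <= 1.
  rewrite -ler_pdivlMl ?mulr1 //.
  by near: n; apply: density_small; rewrite invr_gt0.
(* The summand 1 keeps the constant positive. *)
have Cr : (C1 + C2 + 1) * density n <= e / 2.
  rewrite -ler_pdivlMl; last by lra.
  by near: n; apply: density_small; rewrite mulr_gt0 // invr_gt0; lra.
have itv := @truncn_itv R (x * (n%:R * density n)) _.
have {itv} itv := itv (mulr_ge0 (ltW x0) (mulr_ge0 (ler0n _ _) (ltW r0))).
have lo := survival_lower d_gt0 nd r0 r1 (densityX n0) x0 xy2 yr (proj1 (andP itv)).
have up := survival_upper d_gt0 nd r0 r1 (densityX n0) y10 y1x xy2 yr itv.
rewrite -C2E in lo; rewrite -C1E in up.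
have Cr1 : C1 * density n <= e / 2.
  by apply: le_trans Cr; rewrite ler_wpM2r ?(ltW r0) //; clear -C10 C20; lra.
have Cr2 : C2 * density n <= e / 2.
  by apply: le_trans Cr; rewrite ler_wpM2r ?(ltW r0) //; clear -C10 C20; lra.
have := c2; have := c1; rewrite !ler_norml => /andP[c1' _] /andP[_ c2'].
clear -lo up c1' c2' Cr1 Cr2; by apply/andP; split; lra.
Unshelve. all: by end_near. Qed.

Variables (disp : nat -> measure_display) (T : forall n, measurableType (disp n)).
Variables (P : forall n, probability (T n) R).
Variable pi : forall n, {RV (P n) >-> ordering n}.
Hypothesis pi_unif : forall n, uniform_ordering (pi n).

Lemma cdf_scaled_K n (x : R) : (0 < n)%N -> 0 <= x ->
  cdf (@scaled_K R d n \o pi n : {RV P n >-> R}) x =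
  (1 - survival R n d (Num.trunc (x * (n%:R * density n))))%:E.
Proof.
move=> n0 x0; set k := Num.trunc _.
have b0 : 0 < n%:R * density n by rewrite mulr_gt0 ?ltr0n ?density_gt0.
have -> : cdf (@scaled_K R d n \o pi n : {RV P n >-> R}) x =
    distribution (P n) (pi n) [set s | s \in [set s | (K d s <= k)%N]%SET].
  congr (P n _); apply/seteqP.
  have eqK (s : ordering n) : (scaled_K R d s <= x) = (K d s <= k)%N.
    rewrite /scaled_K powR_density // ler_pdivrMr //.
    by rewrite truncn_ge_nat // mulr_ge0 // ltW.
  by split => t /=; rewrite in_itv /= !inE eqK.
rewrite uniform_orderingE // /survival; congr EFin.
have nf : (n`!%:R : R) != 0 by rewrite pnatr_eq0 -lt0n fact_gt0.
apply: (mulIf nf); rewrite mulrBl !divfK // mul1r.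
rewrite -(card_Sn n) -(cardsC [set s : ordering n | (K d s <= k)%N]%SET) natrD.
rewrite (_ : ~: _ = [set s : ordering n | (k < K d s)%N]%SET) ?addrK //.
by apply/finset.setP => s; rewrite !inE ltnNge.
Qed.

(** At least one vertex has to be deleted before another becomes isolated. *)
Lemma cdf_scaled_K_le0 n (x : R) : (4 * d < n)%N -> x <= 0 ->
  cdf (@scaled_K R d n \o pi n : {RV P n >-> R}) x = 0%E.
Proof.
move=> nd x0; have n0 : (0 < n)%N by lia.
apply/eqP; rewrite eq_le cdf_ge0 andbT.
apply: (@le_trans _ _ (cdf (@scaled_K R d n \o pi n : {RV P n >-> R}) 0)).
  exact: cdf_nondecreasing.
rewrite cdf_scaled_K // mul0r truncn0 lee_fin subr_le0 /survival.
rewrite ler_pdivlMr ?mul1r ?ltr0n ?fact_gt0 // ler_nat -(card_Sn n).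
apply: subset_leq_card; apply/fintype.subsetP => s _; rewrite inE lt0n.
apply/eqP => K0; have /existsP [v] : [exists v, nbhd d v \subset s @: last_positions n 0].
  by apply: K_le_covered => //; rewrite K0.
have -> : last_positions n 0 = finset.set0.
  by apply/finset.setP => i; rewrite !inE subn0 leqNgt ltn_ord.
rewrite imset0 finset.subset0 -cards_eq0 card_nbhd; lia.
Qed.

End Limit.

Theorem theorem6p4 (R : realType) (d : nat) (d_ge1 : (1 <= d)%N)
    (disp : nat -> measure_display) (T : forall n, measurableType (disp n))
    (P : forall n, probability (T n) R)
    (pi : forall n, {RV (P n) >-> ordering n})
    (pi_unif : forall n, uniform_ordering (pi n)) :
  exists (disp' : measure_display) (T' : measurableType disp')
    (Q : probability T' R) (W : {RV Q >-> R}),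
  [/\ cvg_in_distribution P (fun n => @scaled_K R d n \o pi n) W,
      forall x : R, 0 <= x -> ccdf W x = (expR (- (x ^+ (2 * d)%N)))%:E,
      weibull (2 * d)%N%:R W &
      d = 1%N -> forall x : R, 0 <= x -> ccdf W x = (expR (- (x ^+ 2)))%:E].
Proof.
have d2 : (2 * d)%N = (2 * d).-1.+1 by lia.
pose W : {RV weibull_measure R (2 * d).-1 >-> R} := weibull_variable (R := R).
have tail (x : R) : 0 <= x -> ccdf W x = (expR (- (x ^+ (2 * d)%N)))%:E.
  by move=> x0; rewrite ccdf_weibull // -d2.
exists _, _, _, W; split => //; last by move=> d1 x; rewrite d1 in tail *; exact: tail.
- move=> x _; rewrite cdf_weibull; case: (lerP x 0) => x0.
    rewrite weibull_cdf_neg //; apply: cvg_near_cst.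
    exists (4 * d).+1 => // n /= nd; exact: cdf_scaled_K_le0.
  rewrite (weibull_cdf_pos _ (ltW x0)) -d2.
  apply: cvg_trans (_ : (1 - survival R n d
    (Num.trunc (x * (n%:R * density R d n))))%:E @[n --> \oo] --> _).
    apply: near_eq_cvg; exists 1%N => // n /= n0.
    by rewrite cdf_scaled_K // ltW.
  apply: cvg_EFin; first by exists 0%N.
  apply: (@cvgB _ R^o); first exact: cvg_cst.
  exact: survival_cvg.
- split; first by rewrite ltr0n; lia.
  by move=> x x0; rewrite powR_mulrn // tail.
Qed.
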